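(* Let $\alpha(t)=\sum_na_nt^n$ be an adelic series on a number field $\mathbb{K}$ with $a_0=0$ and $a_1\neq0$. Then there exists an adelic series $\beta$ such that $\beta\circ\alpha(t)=t$.
   Context: For a number field $\mathbb{K}$ and a finite set $S$ of places containing the Archimedean ones, $\mathcal{O}_{\mathbb{K},S}$ is the ring of elements of $v$-norm $\le1$ for all $v\notin S$. A formal power series $\sum_na_nt^n$ is adelic on $\mathbb{K}$ if its coefficients lie in $\mathcal{O}_{\mathbb{K},S}$ for some such finite $S$ and, for every place $v$ of $\mathbb{K}$, its radius of convergence $\limsup_n|a_n|_v^{-1/n}$ is positive.
   Formalization: The radius of convergence is taken as the usual 1/limsup |a_n|_v^{1/n}, not the printed limsup |a_n|_v^{-1/n}, which is not the radius of convergence and under which the claim fails for sparse-zero divergent series. *)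

(* Defs.v *)
From HB Require Import structures.
From mathcomp Require Import all_boot all_order all_algebra all_field.
From mathcomp Require Import all_classical all_reals all_analysis.
Set Implicit Arguments. Unset Strict Implicit. Unset Printing Implicit Defensive.
Import Order.TTheory GRing.Theory Num.Theory.
Local Open Scope ring_scope.

Section Adelic.
Variables (R : realType) (K : fieldType).

(* A place of K is represented by an absolute value v : K -> R (a representative
   of the equivalence class); nontrivial. *)
Definition place (v : K -> R) : Prop :=
  [/\ forall x, 0 <= v x,
      forall x, v x = 0 <-> x = 0,
      forall x y, v (x * y) = v x * v y,
      forall x y, v (x + y) <= v x + v y
    & exists x, v x != 0 /\ v x != 1].

Definition equiv_place (v w : K -> R) : Prop :=
  exists c : R, 0 < c /\ forall x, v x = powR (w x) c.

Definition archimedean (v : K -> R) : Prop :=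
  exists x y, Num.max (v x) (v y) < v (x + y).

Definition conv_radius (v : K -> R) (a : nat -> K) : \bar R :=
  let L := limn_esup (fun n => (powR (v (a n)) (n%:R)^-1)%:E) in
  if L == +oo%E then 0%E
  else if L == 0%E then +oo%E
  else ((fine L)^-1)%:E.

Definition S_integral (a : nat -> K) : Prop :=
  exists (m : nat) (S : 'I_m -> (K -> R)),
    [/\ forall i, place (S i),
        forall v, place v -> archimedean v -> exists i, equiv_place v (S i)
      & forall v, place v -> (forall i, ~ equiv_place v (S i)) ->
          forall n, v (a n) <= 1].

Definition adelic (a : nat -> K) : Prop :=
  S_integral a /\ forall v, place v -> (0 < conv_radius v a)%E.

End Adelic.

(* Formal power series are coefficient sequences nat -> K. *)
Section FPS.
Variable K : fieldType.

Fixpoint fps_pow (a : nat -> K) (k : nat) : nat -> K :=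
  match k with
  | 0 => fun n => (n == 0)%:R
  | k'.+1 => fun n => \sum_(i < n.+1) a i * fps_pow a k' (n - i)
  end.

(* b o a, for a with a 0 = 0 (then a^k has order >= k). *)
Definition fps_comp (b a : nat -> K) : nat -> K :=
  fun n => \sum_(k < n.+1) b k * fps_pow a k n.

Definition fps_X : nat -> K := fun n => (n == 1)%:R.
End FPS.

(* Main.v *)
Require Import Defs.
From HB Require Import structures.
From mathcomp Require Import all_boot all_order all_algebra all_field.
From mathcomp Require Import all_classical all_reals all_analysis.
From mathcomp Require Import zify ring lra.
Set Implicit Arguments. Unset Strict Implicit. Unset Printing Implicit Defensive.
Import Order.TTheory GRing.Theory Num.Theory.
Import numFieldNormedType.Exports.
Local Open Scope classical_set_scope.
Local Open Scope ring_scope.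

(** The series [b] with [b o a = X] is given by the recursion
    [b_n a_1^n = X_n - \sum_(k < n) b_k (a^k)_n], so its coefficients lie in
    [Z[1/a_1, a_2, a_3, ...]]: [b] is integral at every place outside [S] where
    [a_1] is a unit.  Only finitely many further places have to be added to [S]:
    clearing denominators in an equation for [1/a_1] gives an integer [N != 0]
    with [v N < 1] whenever [v a_1 < 1], so such a [v] lies above a prime divisor
    of [N], and the pairwise inequivalent places above one prime number at most
    [[K : Q]], because elements separating them (Artin-Whaples) are linearly
    independent over [Q].  Positivity of the radii follows from the majorant
    method applied to [a o b = X], which holds since a one-sided inverse for
    composition is two-sided. *)

(** * Composition of formal power series *)

Section FormalPowerSeries.
Variable K : fieldType.
Implicit Types (a b c : nat -> K) (p q : {poly K}).

Lemma fps_pow_lt a k n : a 0%N = 0 -> (n < k)%N -> fps_pow a k n = 0.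
Proof.
move=> a0; elim: k n => [|k IH] n //= nk.
rewrite big1 // => -[[|i] /= Hi] _; first by rewrite a0 mul0r.
by rewrite IH ?mulr0 //; lia.
Qed.

Lemma fps_pow_diag a n : a 0%N = 0 -> fps_pow a n n = a 1%N ^+ n.
Proof.
move=> a0; elim: n => [|n IH] //=.
rewrite big_ord_recl a0 mul0r add0r big_ord_recl /= subSS subn0 IH -exprS.
rewrite big1 ?addr0 // => i _.
have iln := ltn_ord i; by rewrite fps_pow_lt ?mulr0 //= /bump /=; lia.
Qed.

Lemma fps_pow1 a n : fps_pow a 1 n = a n.
Proof.
rewrite /= big_ord_recr /= subnn eqxx mulr1 big1 ?add0r // => i _.
by rewrite subn_eq0 leqNgt ltn_ord mulr0.
Qed.

Lemma coef_trunc_exp a k M n :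
  (n < M)%N -> fps_pow a k n = ((\poly_(i < M) a i) ^+ k)`_n.
Proof.
elim: k n => [|k IH] n nM; first by rewrite expr0 coef1.
rewrite exprS coefM /=; apply: eq_bigr => i _.
have iM : (i < M)%N by have := ltn_ord i; lia.
by rewrite coef_poly iM IH //; lia.
Qed.

Lemma fps_comp_widen b a M n : a 0%N = 0 -> (n < M)%N ->
  fps_comp b a n = \sum_(k < M) b k * fps_pow a k n.
Proof.
move=> a0 nM; rewrite /fps_comp (big_ord_widen M (fun k => b k * fps_pow a k n)) //.
rewrite big_mkcond; apply: eq_bigr => i _.
by case: ltnP => // ni; rewrite fps_pow_lt ?mulr0.
Qed.

(** Coefficients below [M] depend only on truncations, so identities between series reduce to
    identities between polynomials modulo ['X^M]. *)
Lemma coef_trunc_comp b a M n : a 0%N = 0 -> (n < M)%N ->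
  fps_comp b a n = ((\poly_(i < M) b i) \Po (\poly_(i < M) a i))`_n.
Proof.
move=> a0 nM; rewrite (fps_comp_widen _ a0 nM).
rewrite [X in X \Po _]poly_def linear_sum coef_sum; apply: eq_bigr => i _.
by rewrite /= comp_polyZ comp_Xn_poly coefZ -coef_trunc_exp.
Qed.

Lemma dvd_Xn_coefP M p : reflect (forall n, (n < M)%N -> p`_n = 0) ('X^M %| p).
Proof.
apply: (iffP idP) => [/dvdpP[q ->] n nM|H]; first by rewrite coefMXn nM.
apply/dvdpP; exists (drop_poly M p); rewrite -[LHS](poly_take_drop M).
rewrite [take_poly M p](_ : _ = 0) ?add0r //.
by apply/polyP => i; rewrite coef_take_poly coef0; case: ifP => // /H.
Qed.

Lemma dvdp_comp_sub p q (s : {poly K}) : q - s %| (p \Po q) - (p \Po s).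
Proof.
elim/poly_ind: p => [|p d IH]; first by rewrite !comp_poly0 subrr dvdp0.
rewrite !comp_polyD !comp_polyM !comp_polyX !comp_polyC.
rewrite [X in _ %| X](_ : _ = ((p \Po q) - (p \Po s)) * q + (p \Po s) * (q - s)).
  by apply: dvdp_add; [exact: dvdp_mulr|exact: dvdp_mull].
by ring.
Qed.

(** Polynomial composition is associative, and replacing a composite by its truncation changes it
    only by a multiple of ['X^M]. *)
Lemma fps_compA c b a : a 0%N = 0 -> b 0%N = 0 ->
  fps_comp (fps_comp c b) a = fps_comp c (fps_comp b a).
Proof.
move=> a0 b0; apply/funext => n; set M := n.+1.
have ba0 : fps_comp b a 0%N = 0 by rewrite /fps_comp big_ord1 b0 mul0r.
rewrite (coef_trunc_comp _ a0 (ltnSn n)) (coef_trunc_comp _ ba0 (ltnSn n)) -/M.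
apply/eqP; rewrite -subr_eq0; apply/eqP.
set A := \poly_(i < M) a i; set B := \poly_(i < M) b i.
set C := \poly_(i < M) c i.
set CB := \poly_(i < M) _; set BA := \poly_(i < M) _.
have dCB : 'X^M %| CB - (C \Po B).
  apply/dvd_Xn_coefP => i iM.
  by rewrite coefB coef_poly iM (@coef_trunc_comp _ _ M) // subrr.
have dBA : 'X^M %| (B \Po A) - BA.
  apply/dvd_Xn_coefP => i iM.
  by rewrite coefB coef_poly iM (@coef_trunc_comp _ _ M) // subrr.
have dA : 'X %| A.
  by rewrite -['X]expr1; apply/dvd_Xn_coefP => -[|//] _; rewrite coef_poly /= a0.
suff /dvd_Xn_coefP/(_ n (leqnn _)) : 'X^M %| (CB \Po A) - (C \Po BA) by rewrite coefB.
(* The polynomial [C \Po B \Po A] is inserted between the two sides. In the first difference ['X^M]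
   becomes [A ^+ M], still a multiple of ['X^M] because ['X %| A]. *)
rewrite (_ : _ - _ = ((CB - (C \Po B)) \Po A) + ((C \Po (B \Po A)) - (C \Po BA))).
  apply: dvdp_add; last exact: dvdp_trans dBA (dvdp_comp_sub _ _ _).
  have /dvdpP[D ->] := dCB.
  rewrite comp_polyM comp_Xn_poly; apply: dvdp_mull; exact: dvdp_exp2r.
by rewrite comp_polyB comp_polyA; ring.
Qed.

Lemma trunc_fps_X n : \poly_(i < n.+2) fps_X K i = 'X.
Proof.
apply/polyP => i; rewrite coef_poly coefX /fps_X.
by case: ltnP => //; case: i => [|[]].
Qed.

Lemma fps_compX c : fps_comp c (fps_X K) = c.
Proof.
apply/funext => n; rewrite (@coef_trunc_comp c (fps_X K) n.+2) //.
by rewrite trunc_fps_X comp_polyXr coef_poly leqW.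
Qed.

Lemma fps_Xcomp a : a 0%N = 0 -> fps_comp (fps_X K) a = a.
Proof.
move=> a0; apply/funext => n; rewrite (@coef_trunc_comp (fps_X K) a n.+2) //.
by rewrite trunc_fps_X comp_polyX coef_poly leqW.
Qed.

(** * The compositional left inverse *)

Section LeftInverse.
Variable a : nat -> K.

(** Each coefficient depends on all earlier ones; carrying them in a list makes the recursion
    structural. *)
Fixpoint linv_prefix n : seq K :=
  if n is n'.+1 then
    let s := linv_prefix n' in
    rcons s ((fps_X K n' - \sum_(k < n') s`_k * fps_pow a k n') / a 1%N ^+ n')
  else [::].

Definition fps_linv n : K := (linv_prefix n.+1)`_n.

Lemma size_linv_prefix n : size (linv_prefix n) = n.
Proof. by elim: n => //= n IH; rewrite size_rcons IH. Qed.

Lemma nth_linv_prefix n k : (k < n)%N -> (linv_prefix n)`_k = fps_linv k.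
Proof.
elim: n => // n IH; rewrite ltnS leq_eqVlt => /predU1P[->//|kn].
by rewrite /= nth_rcons size_linv_prefix kn IH.
Qed.

Lemma fps_linvE n : fps_linv n =
  (fps_X K n - \sum_(k < n) fps_linv k * fps_pow a k n) / a 1%N ^+ n.
Proof.
rewrite {1}/fps_linv /= nth_rcons size_linv_prefix ltnn eqxx.
by under eq_bigr => k _ do rewrite nth_linv_prefix //.
Qed.

Hypotheses (a0 : a 0%N = 0) (a1 : a 1%N != 0).

Lemma fps_linvK : fps_comp fps_linv a = fps_X K.
Proof.
apply/funext => n; rewrite /fps_comp big_ord_recr /= fps_pow_diag //.
by rewrite fps_linvE divfK ?expf_neq0 // addrC subrK.
Qed.

Lemma fps_linv0 : fps_linv 0%N = 0.
Proof. by rewrite fps_linvE big_ord0 subr0 mul0r. Qed.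

Lemma fps_linv1 : fps_linv 1%N = (a 1%N)^-1.
Proof. by rewrite fps_linvE big_ord1 fps_linv0 mul0r subr0 mul1r. Qed.

End LeftInverse.

(* If c o b = X and b o a = X then c = c o (b o a) = (c o b) o a = a. *)
Lemma fps_linvKr a : a 0%N = 0 -> a 1%N != 0 ->
  fps_comp a (fps_linv a) = fps_X K.
Proof.
move=> a0 a1; set b := fps_linv a.
have b0 : b 0%N = 0 by exact: fps_linv0.
have b1 : b 1%N != 0 by rewrite /b fps_linv1 // invr_eq0.
rewrite -(_ : fps_linv b = a) ?fps_linvK //.
by rewrite -[LHS]fps_compX -(fps_linvK a0 a1) -fps_compA // fps_linvK // fps_Xcomp.
Qed.

End FormalPowerSeries.

(** * Absolute values, their equivalence and their separation *)

Section Places.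
Variables (R : realType) (K : fieldType).
Implicit Types (v w : K -> R) (x y z : K).

Section OnePlace.
Variable v : K -> R.
Hypothesis pv : place v.

Lemma place_ge0 x : 0 <= v x. Proof. by case: pv. Qed.

Lemma placeM x y : v (x * y) = v x * v y. Proof. by case: pv. Qed.

Lemma placeD x y : v (x + y) <= v x + v y. Proof. by case: pv. Qed.

Lemma place0 : v 0 = 0. Proof. by case: pv => _ H _ _ _; apply/H. Qed.

Lemma place_eq0 x : (v x == 0) = (x == 0).
Proof. by case: pv => _ H _ _ _; apply/eqP/eqP => /H. Qed.

Lemma place_gt0 x : (0 < v x) = (x != 0).
Proof. by rewrite lt_def place_ge0 andbT place_eq0. Qed.

Lemma place1 : v 1 = 1.
Proof.
have v1 : v 1 != 0 by rewrite place_eq0 oner_eq0.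
by apply: (mulfI v1); rewrite -placeM !mulr1.
Qed.

Lemma placeX x n : v (x ^+ n) = v x ^+ n.
Proof. by elim: n => [|n IH]; rewrite ?place1 // !exprS placeM IH. Qed.

Lemma placeV x : v x^-1 = (v x)^-1.
Proof.
have [->|x0] := eqVneq x 0; first by rewrite invr0 place0 invr0.
have vx : v x != 0 by rewrite place_eq0.
by apply: (mulfI vx); rewrite -placeM !divff ?place1.
Qed.

Lemma placeN x : v (- x) = v x.
Proof.
have : v (-1) ^+ 2 = 1 by rewrite -placeX sqrrN expr1n place1.
move/eqP; rewrite sqrf_eq1 => /orP[]/eqP vN1.
  by rewrite -mulN1r placeM vN1 mul1r.
by have := place_ge0 (-1); rewrite vN1 lerNr oppr0 ler10.
Qed.

Lemma place_sum I (r : seq I) (P : pred I) (F : I -> K) :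
  v (\sum_(i <- r | P i) F i) <= \sum_(i <- r | P i) v (F i).
Proof.
elim/big_rec2: _ => [|i y x _ IH]; first by rewrite place0.
by apply: le_trans (placeD _ _) _; rewrite lerD2l.
Qed.

Lemma place_gt1 : exists x, 1 < v x.
Proof.
case: pv => _ _ _ _ [x [x0 x1]].
have [?|vx|/eqP] := ltgtP (v x) 1; [|by exists x|by rewrite (negPf x1)].
by exists x^-1; rewrite placeV invf_gt1 // lt_def x0 place_ge0.
Qed.

Hypothesis nav : ~ archimedean v.

Lemma place_ultra x y : v (x + y) <= Num.max (v x) (v y).
Proof. by rewrite leNgt; apply/negP => xy; apply: nav; exists x, y. Qed.

Lemma place_ultra_sum I (r : seq I) (P : pred I) (F : I -> K) B : 0 <= B ->
  (forall i, P i -> v (F i) <= B) -> v (\sum_(i <- r | P i) F i) <= B.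
Proof.
move=> B0 H; elim/big_rec: _ => [|i x Pi IH]; first by rewrite place0.
by rewrite (le_trans (place_ultra _ _)) // ge_max IH H.
Qed.

Lemma place_nat n : v n%:R <= 1.
Proof.
elim: n => [|n IH]; first by rewrite place0.
by rewrite -natr1 (le_trans (place_ultra _ _)) // ge_max IH place1 lexx.
Qed.

Lemma place_int (n : int) : v n%:~R <= 1.
Proof. by case: n => n; rewrite ?NegzE ?mulrNz ?placeN place_nat. Qed.

(** Otherwise [x = (x + y) - y] would be a sum of two elements of norm below [v x]. *)
Lemma place_isosceles x y : v y < v x -> v (x + y) = v x.
Proof.
move=> yx; apply/eqP; rewrite eq_le; apply/andP; split.
  by rewrite (le_trans (place_ultra _ _)) // ge_max lexx ltW.
rewrite leNgt; apply/negP => H.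
have := place_ultra (x + y) (- y).
by rewrite addrK placeN leNgt gt_max H yx.
Qed.

(** If [p] does not divide [n], a Bezout relation writes 1 as a combination of [p] and [n]; both
    having norm below 1 would force [v 1 < 1]. *)
Lemma place_prime_dvd p n : prime p -> v p%:R < 1 ->
  (v n%:R < 1) = (p %| n)%N.
Proof.
move=> pp vp; apply/idP/idP => [vn|/dvdnP[k ->]].
  apply/negPn/negP; rewrite -prime_coprime // => /eqP cop.
  have [u [t ut]] : exists u t, (u * p)%N = (t * n + 1)%N.
    by have [u t e _] := egcdnP n (prime_gt0 pp); exists u, t; rewrite e cop.
  have : v 1 < 1.
    have -> : 1 = (u * p)%:R - (t * n)%:R :> K by rewrite ut natrD addrAC subrr add0r.
    apply: le_lt_trans (place_ultra _ _) _; rewrite placeN gt_max !natrM !placeM.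
    by apply/andP; split; [apply: le_lt_trans vp|apply: le_lt_trans vn];
      rewrite ler_piMl ?place_ge0 ?place_nat.
  by rewrite place1 ltxx.
rewrite natrM placeM; apply: le_lt_trans vp.
by rewrite ler_piMl ?place_ge0 ?place_nat.
Qed.

Lemma place_lt1_prime n : (0 < n)%N -> v n%:R < 1 ->
  exists2 p, p \in primes n & v p%:R < 1.
Proof.
elim/ltn_ind: n => n IH n0 vn.
have n1 : (1 < n)%N by case: n {IH} n0 vn => [|[|]] //; rewrite place1 ltxx.
have pp := pdiv_prime n1; have [k nE] := dvdnP (pdiv_dvd n).
have [vp|vp] := ltP (v (pdiv n)%:R) 1.
  by exists (pdiv n) => //; rewrite mem_primes pp n0 pdiv_dvd.
have vp1 : v (pdiv n)%:R = 1 by apply/eqP; rewrite eq_le place_nat vp.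
have p1 := prime_gt1 pp.
have k0 : (0 < k)%N by move: n0; rewrite nE muln_gt0 => /andP[].
have kn : (k < n)%N by rewrite nE -[X in (X < _)%N]muln1 ltn_pmul2l.
have [|q qk vq] := IH k kn k0; first by move: vn; rewrite nE natrM placeM vp1 mulr1.
exists q => //; move: qk; rewrite !mem_primes n0 k0 => /andP[-> /= qk].
by rewrite nE dvdn_mulr.
Qed.

End OnePlace.

Lemma equiv_place_sym v w : place v -> place w ->
  equiv_place v w -> equiv_place w v.
Proof.
move=> pv pw [c [c0 H]]; exists c^-1; split; first by rewrite invr_gt0.
by move=> x; rewrite H -powRrM divff ?gt_eqF // powRr1 // place_ge0.
Qed.

(* For [v y > 1] and [x != 0], comparing [x ^ n] with [y ^ m] shows that
   [ln (v x) / ln (v y)] and [ln (w x) / ln (w y)] have the same position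
   relative to every rational [m / n]. *)
Lemma place_lt1_equiv v w : place v -> place w ->
  (forall x, v x < 1 -> w x < 1) -> equiv_place v w.
Proof.
move=> pv pw H.
have H' x : 1 < v x -> 1 < w x.
  move=> vx; have x0 : 0 < v x by apply: lt_trans vx.
  have := H x^-1; rewrite !placeV // invf_lt1 // => /(_ vx).
  by rewrite invf_lt1 // place_gt0 // -(place_gt0 pv).
have [y vy] := place_gt1 pv.
have wy := H' y vy.
have lv : 0 < ln (v y) by rewrite ln_gt0.
have lw : 0 < ln (w y) by rewrite ln_gt0.
have y0 : y != 0 by rewrite -(place_gt0 pv) (lt_trans _ vy).
have lnX (u : K -> R) z n : place u -> z != 0 -> ln (u (z ^ n)) = n%:~R * ln (u z).
  move=> pu z0; case: n => n.
    by rewrite -exprnP placeX // lnXn ?place_gt0 // mulr_natl.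
  rewrite NegzE -invr_expz -exprnP placeV // placeX // lnV ?lnXn ?place_gt0 //.
    by rewrite -mulr_natl mulrNz mulNr.
  by rewrite posrE exprn_gt0 // place_gt0.
have lt1 (u : K -> R) z : place u -> z != 0 -> (u z < 1) = (ln (u z) < 0).
  by move=> pu z0; rewrite -(@ln1 R) ltr_ln // posrE ?place_gt0.
have key x : x != 0 -> ln (w x) / ln (w y) <= ln (v x) / ln (v y).
  move=> x0; rewrite leNgt; apply/negP => lt.
  (* A rational strictly between the two ratios yields an element [z] with [v z < 1] and
     [w z > 1]. *)
  have [q] := rat_in_itvoo lt; rewrite in_itv /= => /andP[q1 q2].
  pose z := x ^ denq q / y ^ numq q.
  have z0 : z != 0 by rewrite mulf_neq0 // ?invr_eq0 expfz_neq0.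
  have d0 : 0 < (denq q)%:~R :> R by rewrite ltr0z denq_gt0.
  have qE : ratr q = (numq q)%:~R / (denq q)%:~R :> R by [].
  have lnz (u : K -> R) : place u -> ln (u z) = (denq q)%:~R * ln (u x) - (numq q)%:~R * ln (u y).
    move=> pu; rewrite placeM // placeV // lnM ?lnV ?posrE ?invr_gt0 ?place_gt0 ?expfz_neq0 //.
    by rewrite !lnX.
  have : v z < 1.
    rewrite lt1 // lnz // subr_lt0.
    by move: q1; rewrite qE ltr_pdivrMr // mulrAC ltr_pdivlMr // mulrC.
  move/H; rewrite lt1 // lnz // subr_lt0.
  move: q2; rewrite qE ltr_pdivlMr // mulrAC ltr_pdivrMr //; rewrite [ltRHS]mulrC => q2 q3.
  by have := lt_trans q2 q3; rewrite ltxx.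
exists (ln (v y) / ln (w y)); split; first exact: divr_gt0.
move=> x; have [->|x0] := eqVneq x 0.
  by rewrite !place0 // powR0 // gt_eqF // divr_gt0.
have e : ln (w x) / ln (w y) = ln (v x) / ln (v y).
  apply/eqP; rewrite eq_le key //=.
  (* Inversion changes the sign of both logarithms, which turns [key] into the reverse
     inequality. *)
  have := key x^-1; rewrite invr_eq0 => /(_ x0).
  by rewrite !placeV // !lnV ?posrE ?place_gt0 // !mulNr lerN2.
apply: ln_inj; rewrite ?posrE ?powR_gt0 ?place_gt0 // ln_powR.
by rewrite mulrAC -mulrA e mulrC divfK // gt_eqF.
Qed.

Lemma place_separate2 v w : place v -> place w -> ~ equiv_place v w ->
  exists x, 1 < v x /\ w x < 1.
Proof.
move=> pv pw vw.
have wv : ~ equiv_place w v by move/(equiv_place_sym pw pv).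
have sep (v1 v2 : K -> R) : place v1 -> place v2 -> ~ equiv_place v1 v2 ->
    exists x, v1 x < 1 /\ 1 <= v2 x.
  move=> p1 p2; apply: contra_notP => /forallNP H; apply: place_lt1_equiv => // x v1x.
  by rewrite ltNge; apply/negP => v2x; apply: (H x).
have [x [vx wx]] := sep _ _ pv pw vw.
have [y [wy vy]] := sep _ _ pw pv wv.
have x0 : x != 0 by rewrite -(place_gt0 pw) (lt_le_trans _ wx).
(* Here [v x < 1 <= w x] and [w y < 1 <= v y], so the quotient is large at [v] and small at [w]. *)
exists (y / x); rewrite !placeM // !placeV //.
rewrite ltr_pdivlMr ?ltr_pdivrMr ?place_gt0 // !mul1r.
by split; [exact: lt_le_trans vy|exact: lt_le_trans wx].
Qed.

Lemma expr_mul_lt1_near (q c : R) : 0 <= q -> q < 1 ->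
  \forall r \near \oo, q ^+ r * c < 1.
Proof.
move=> q0 q1.
have : (q ^+ r * c @[r --> \oo] --> 0 * c)%classic.
  by apply: cvgMl; apply: cvg_expr; rewrite ger0_norm.
by rewrite mul0r => /cvgr_lt; apply.
Qed.

(** Artin-Whaples by induction: [z] separates [v] from all selected places but the last, [y]
    separates it from the last. The predicate [P] allows [v] itself to occur in the family, with its
    index left out. *)
Lemma place_separate v n (f : 'I_n -> K -> R) (P : pred 'I_n) :
  place v -> ~ archimedean v ->
  (forall i, P i -> place (f i) /\ ~ archimedean (f i)) ->
  (forall i, P i -> ~ equiv_place v (f i)) ->
  exists x, 1 < v x /\ forall i, P i -> f i x < 1.
Proof.
move=> pv nav; elim: n f P => [|n IH] f P Pf ne.
  by have [x vx] := place_gt1 pv; exists x; split=> // -[].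
have [z [vz fz]] := IH (fun i => f (lift ord_max i)) (fun i => P (lift ord_max i))
  (fun i => Pf _) (fun i => ne _).
have [Pm|Pm] := boolP (P ord_max); last first.
  exists z; split=> // i; case: (unliftP ord_max i) => [j ->|-> Pm']; first exact: fz.
  by rewrite Pm' in Pm.
have [pm nam] := Pf _ Pm.
have [y [vy my]] := place_separate2 pv pm (ne _ Pm).
(* One exponent serves all the finitely many places where [z] is small; it is taken positive so that
   powers of [z] keep strict inequalities with 1. *)
have [r Hr] : exists r, forall i, P (lift ord_max i) ->
    f (lift ord_max i) z ^+ r.+1 * f (lift ord_max i) y < 1.
  have : \forall r \near \oo, forall i, P (lift ord_max i) ->
      f (lift ord_max i) z ^+ r * f (lift ord_max i) y < 1.
    apply: filter_forall => i; have [Pi|Pi] := boolP (P (lift ord_max i)).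
      have [pfi _] := Pf _ Pi.
      have Hi := expr_mul_lt1_near (f (lift ord_max i) y) (place_ge0 pfi z) (fz _ Pi).
      by apply: filterS Hi => r.
    by apply: nearW.
  by case=> r _ H; exists r; apply: H => /=.
have vzr : 1 < v z ^+ r.+1 by rewrite exprn_egt1.
have [mz|mz] := leP (f ord_max z) 1.
  exists (z ^+ r.+1 * y); split.
    by rewrite placeM // placeX // mulr_egt1.
  move=> i Pi; have [pfi nai] := Pf _ Pi; rewrite placeM // placeX //.
  case: (unliftP ord_max i) Pi => [j ->|->] Pi; first exact: Hr.
  by apply: le_lt_trans my; rewrite ler_piMl ?place_ge0 // exprn_ile1 ?place_ge0.
(* When [z] is large at the last place too, the factor [z^(r+1) / (z^(r+1) + 1)] replaces the power:
   by the ultrametric inequality its norm is exactly 1 where [z] is large, and that of [z^(r+1)]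
   where [z] is small. *)
have big (u : K -> R) : place u -> ~ archimedean u -> 1 < u z ->
    u (z ^+ r.+1 / (z ^+ r.+1 + 1) * y) = u y.
  move=> pu nau uz; rewrite !placeM // placeV // place_isosceles //.
    by rewrite divff ?mul1r // place_eq0 // expf_neq0 // -(place_gt0 pu) (lt_trans _ uz).
  by rewrite place1 // placeX // exprn_egt1.
exists (z ^+ r.+1 / (z ^+ r.+1 + 1) * y); split; first by rewrite big.
move=> i Pi; have [pfi nai] := Pf _ Pi.
case: (unliftP ord_max i) Pi pfi nai => [j ->|->] Pi pfi nai; last by rewrite big.
rewrite !placeM // placeV // addrC place_isosceles // ?place1 // ?invr1 ?mulr1 placeX //.
  exact: Hr.
by rewrite exprn_ilt1 ?place_ge0 // fz.
Qed.

End Places.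

(** * Finite systems of representatives *)

(** If no finite family were complete, every family of pairwise unrelated elements could be
    extended, up to size [D.+1]. Symmetry is what lets the new element be compared in both
    orders. *)
Lemma finite_representatives (T : Type) (e : T -> T -> Prop) (P : T -> Prop) D :
  (forall x y, P x -> P y -> e x y -> e y x) ->
  (forall n (f : 'I_n -> T), (forall i, P (f i)) ->
     (forall i j, i != j -> ~ e (f i) (f j)) -> (n <= D)%N) ->
  exists n (f : 'I_n -> T),
    (forall i, P (f i)) /\ forall x, P x -> exists i, e x (f i).
Proof.
move=> esym bnd; apply: contrapT => /forallNP H.
suff [f [Pf ef]] : exists f : 'I_D.+1 -> T, (forall i, P (f i)) /\
    forall i j, i != j -> ~ e (f i) (f j).
  by have := bnd _ _ Pf ef; rewrite ltnn.
elim: D.+1 => [|n [f [Pf ef]]].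
  by exists (fun i : 'I_0 => match notF (ltn_ord i) with end); split=> -[].
have [x Px ex] : exists2 x, P x & forall i, ~ e x (f i).
  apply: contrapT => /forall2NP H'; apply: (H n); exists f; split=> // x Px.
  by apply: contrapT => /forallNP ex; case: (H' x).
exists (fun i => if unlift ord_max i is Some j then f j else x); split.
  by move=> i; case: unliftP.
move=> i j; case: unliftP => [i' ->|->]; case: unliftP => [j' ->|->] //.
- by rewrite (inj_eq lift_inj); exact: ef.
- by move=> _ /esym H'; apply: (ex i'); apply: H'.
by rewrite eqxx.
Qed.

Lemma family_cat (T : Type) m n (f : 'I_m -> T) (g : 'I_n -> T) :
  exists h : 'I_(m + n) -> T,
    [/\ forall P : T -> Prop, (forall i, P (f i)) -> (forall i, P (g i)) ->
          forall i, P (h i),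
        forall i, exists j, h j = f i & forall i, exists j, h j = g i].
Proof.
exists (fun i => match fintype.split i with inl j => f j | inr j => g j end).
split=> [P Pf Pg i|i|i]; first by case: fintype.split.
  by exists (unsplit (inl i)); rewrite unsplitK.
by exists (unsplit (inr i)); rewrite unsplitK.
Qed.

(** * Places of a number field above a prime *)

Section NumberField.
Variables (R : realType) (K : fieldExtType rat).
Implicit Types (v w : K -> R) (x y : K).

Definition above (p : nat) v := [/\ place v, ~ archimedean v & v p%:R < 1].

Lemma int_alg_eq0 (n : int) : (n%:~R == 0 :> K) = (n == 0).
Proof. by rewrite -(rmorph_int (in_alg K)) fmorph_eq0 intr_eq0. Qed.

Lemma place_abszE v (n : int) : place v -> v n%:~R = v `|n|%N%:R.
Proof. by move=> pv; case: n => n //; rewrite NegzE mulrNz placeN // abszN. Qed.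

Lemma place_rat v (q : rat) : place v ->
  v q%:A = v `|numq q|%N%:R / v `|denq q|%N%:R.
Proof.
move=> pv; rewrite -!place_abszE // -placeV // -placeM //; congr v.
by rewrite -[in LHS](divq_num_den q) -[LHS]/(in_alg K _) fmorph_div !rmorph_int.
Qed.

(** At either place the condition says that [p] does not divide the denominator of [q], which does
    not depend on the place. *)
Lemma above_rat_le1 p v w (q : rat) : prime p -> above p v -> above p w ->
  v q%:A <= 1 -> w q%:A <= 1.
Proof.
move=> pp av aw; have [pv nav vp] := av; have [pw naw wp] := aw.
rewrite !place_rat //.
have nat1 (u : K -> R) n : above p u -> ~~ (p %| n)%N -> u n%:R = 1.
  move=> [pu nau up]; rewrite -(place_prime_dvd pu) // -leNgt => un.
  by apply/eqP; rewrite eq_le place_nat.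
have [pd|pd] := boolP (p %| `|denq q|)%N; last first.
  by rewrite (nat1 v _ av pd) (nat1 w _ aw pd) !divr1 => _; exact: place_nat.
have pn : ~~ (p %| `|numq q|)%N.
  apply/negP => pn; have := dvdn_gcd p `|numq q| `|denq q|.
  by rewrite pn pd (eqP (coprime_num_den q)) dvdn1 gtn_eqF ?prime_gt1.
have d0 : 0 < v `|denq q|%N%:R by rewrite -place_abszE // place_gt0 // int_alg_eq0.
rewrite nat1 // mul1r invf_le1 // leNgt.
by rewrite (place_prime_dvd pv nav _ pp vp) pd.
Qed.

(** Elements [x i], each large at [f i] and small at the other places, are linearly independent over
    the rationals: in a relation, the term with the dominant coefficient cannot be cancelled. *)
Lemma above_bound p n (f : 'I_n -> K -> R) : prime p ->
  (forall i, above p (f i)) -> (forall i j, i != j -> ~ equiv_place (f i) (f j)) ->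
  (n <= \dim {:K})%N.
Proof.
move=> pp fp ne.
have /fin_all_exists[x Hx] : forall i, exists x, 1 < f i x /\
    forall j, j != i -> f j x < 1.
  move=> i; have [? ? _] := fp i.
  apply: (@place_separate _ _ (f i) n f (fun j => j != i)) => //.
    by move=> j _; have [] := fp j.
  by move=> j; rewrite eq_sym => /ne.
suff /eqP fr : free [tuple x i | i < n].
  by rewrite -(size_tuple [tuple x i | i < n]) -fr dimvS // subvf.
apply/freeP => k k0 i; apply/eqP/negPn/negP => ki.
have [pfi nai vi] := fp i.
(* The dominant coefficient is chosen with respect to the single place [f i]; [above_rat_le1] then
   transfers the bound on the quotients [k l / k j] to [f j]. *)
have [j _ jmax] := @arg_maxP _ R 'I_n i xpredT (fun j => f i (k j)%:A) isT.
have alg0 (q : rat) : (q%:A == 0 :> K) = (q == 0) by exact: (fmorph_eq0 (in_alg K)).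
have kj : k j != 0.
  rewrite -alg0 -(place_gt0 pfi); apply: lt_le_trans (jmax i isT).
  by rewrite place_gt0 // alg0.
have [pj naj vj] := fp j.
have qle l : f j (k l / k j)%:A <= 1.
  apply: (@above_rat_le1 p (f i)) => //.
  rewrite -[_%:A]/(in_alg K _) fmorph_div placeM // placeV //.
  rewrite ler_pdivrMr ?mul1r; first exact: jmax.
  by rewrite place_gt0 // fmorph_eq0.
have : \sum_(l < n) (k l / k j) *: x l = 0.
  have := congr1 (GRing.scale (k j)^-1) k0; rewrite scaler0 scaler_sumr => k0'.
  rewrite -[RHS]k0'; apply: eq_bigr => l _.
  by rewrite scalerA mulrC -tnth_nth tnth_mktuple.
rewrite (bigD1 j) //= divff // scale1r => /eqP; rewrite addr_eq0 => /eqP xj.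
have [/lt_geF /negP + _] := Hx j; apply.
rewrite xj placeN //; apply: place_ultra_sum => // l lj.
rewrite -mulr_algl placeM //; apply: mulr_ile1; rewrite ?place_ge0 //.
by rewrite ltW // (Hx l).2 // eq_sym.
Qed.

Lemma above_finite p : prime p -> exists n (f : 'I_n -> K -> R),
  (forall i, above p (f i)) /\
  forall v, above p v -> exists i, equiv_place v (f i).
Proof.
move=> pp; apply: finite_representatives => [v w [pv _ _] [pw _ _]|].
  exact: equiv_place_sym.
by move=> n f; exact: above_bound.
Qed.

Lemma int_poly_root y : exists2 s : {poly int}, s != 0 & root (map_poly intr s) y.
Proof.
have /polyOver1P[q qE] := minPolyOver 1%AS y.
have [s [c c0 sE]] := rat_poly_scale q.
have q0 : q != 0 by rewrite -(map_poly_eq0 (in_alg K)) -qE monic_neq0 ?monic_minPoly.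
exists s; first by apply: contra_neq q0 => s0; rewrite sE s0 rmorph0 scaler0.
have := root_minPoly 1%AS y; rewrite qE sE.
rewrite map_polyZ -map_poly_comp rootZ.
  by rewrite (eq_map_poly (rmorph_int _)).
by rewrite fmorph_eq0 invr_eq0 intr_eq0.
Qed.

(** [N] is the leading coefficient, up to sign, of an integer polynomial vanishing at [y = x^-1]. If
    [v N] were 1 while [v y > 1], the leading term would exceed all the others in norm. *)
Lemma place_lt1_nat x : x != 0 -> exists2 N, (0 < N)%N &
  forall v, place v -> ~ archimedean v -> v x < 1 -> v N%:R < 1.
Proof.
move=> x0; have [s s0 sy] := int_poly_root x^-1; exists `|lead_coef s|%N.
  by rewrite absz_gt0 lead_coef_eq0.
move=> v pv nav vx; rewrite -place_abszE // ltNge; apply/negP => v1.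
set y := x^-1 in sy; have vy : 1 < v y by rewrite placeV // invf_gt1 // place_gt0.
have size0 : (0 < size s)%N by rewrite size_poly_gt0.
have yE : (lead_coef s)%:~R * y ^+ (size s).-1 =
    - \sum_(i < (size s).-1) (s`_i)%:~R * y ^+ i.
  apply/eqP; rewrite -addr_eq0 addrC; move: sy.
  rewrite rootE (@horner_coef_wide _ (size s)) ?size_poly //.
  case: (size s) size0 (lead_coefE s) => // d _ /= ->; rewrite big_ord_recr /= coef_map.
  by under eq_bigr do rewrite coef_map.
have vle : v y ^+ (size s).-1 <= v ((lead_coef s)%:~R * y ^+ (size s).-1).
  by rewrite placeM // placeX // ler_peMl // exprn_ge0 // place_ge0.
have y0 : 0 < v y by apply: lt_trans vy.
(* In degree 0 the sum is empty and the inequality reads [1 <= 0]; otherwise the lower terms have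
   norm at most [v y ^+ d]. *)
move: vle; rewrite yE placeN //; case: (size s).-1 => [|d].
  by rewrite big_ord0 place0 // expr0 ler10.
apply/negP; rewrite -ltNge; apply: (@le_lt_trans _ _ (v y ^+ d)); last first.
  by rewrite ltr_eXn2l.
apply: place_ultra_sum => //; first by rewrite exprn_ge0 // ltW.
move=> i _; rewrite placeM // placeX //.
apply: (@le_trans _ _ (v y ^+ i)); first by rewrite ler_piMl ?exprn_ge0 ?(ltW y0) // place_int.
by rewrite ler_eXn2l // -ltnS.
Qed.

Lemma above_seq_finite (s : seq nat) : all prime s ->
  exists n (f : 'I_n -> K -> R), (forall i, place (f i)) /\
  forall p v, p \in s -> above p v -> exists i, equiv_place v (f i).
Proof.
elim: s => [_|p s IH /= /andP[pp /IH[n [f [pf Hf]]]]].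
  by exists 0%N, (fun i : 'I_0 => match notF (ltn_ord i) with end); split=> -[].
have [m [g [pg Hg]]] := above_finite pp.
have [h [hP hg hf]] := family_cat g f; exists (m + n)%N, h.
split=> [|q v]; first by apply: hP => // j; have [] := pg j.
rewrite inE => /predU1P[-> /Hg[i vi]|/Hf H /H[i vi]].
  by have [j hj] := hg i; exists j; rewrite hj.
by have [j hj] := hf i; exists j; rewrite hj.
Qed.

Lemma place_lt1_finite x : x != 0 -> exists n (f : 'I_n -> K -> R),
  (forall i, place (f i)) /\
  forall v, place v -> ~ archimedean v -> v x < 1 -> exists i, equiv_place v (f i).
Proof.
move=> /place_lt1_nat[N N0 HN].
have [|n [f [pf Hf]]] := @above_seq_finite (primes N).
  by apply/allP => p; rewrite mem_primes => /andP[].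
exists n, f; split=> // v pv nav /(HN v pv nav) vN.
have [p pN vp] := place_lt1_prime pv nav N0 vN.
by apply: (Hf p).
Qed.

End NumberField.

(** * Radius of convergence and geometric growth *)

Section ConvRadius.
Variables (R : realType) (K : fieldType) (v : K -> R).
Hypothesis pv : place v.
Implicit Types a b : nat -> K.

Lemma root_geometric (x M : R) n : (0 < n)%N -> 0 <= x -> 0 <= M ->
  (x `^ n%:R^-1 <= M) = (x <= M ^+ n).
Proof.
move=> n0 x0 M0; rewrite -[RHS](_ : (x `^ n%:R^-1) ^+ n <= M ^+ n = _).
  by rewrite ler_pXn2r // ?nnegrE ?powR_ge0.
by rewrite -powR_mulrn ?powR_ge0 // -powRrM mulVf ?powRr1 // pnatr_eq0 -lt0n.
Qed.

(** Cauchy-Hadamard: a finite limsup of the roots amounts to a geometric bound. Index 0 is left out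
    since [C ^+ 0 = 1] would constrain the constant term. *)
Lemma conv_radius_gt0P a : (0 < conv_radius v a)%E <->
  exists2 C : R, 0 < C & forall n, (0 < n)%N -> v (a n) <= C ^+ n.
Proof.
pose u n : \bar R := (v (a n) `^ n%:R^-1)%:E.
have u0 n : (0 <= u n)%E by rewrite lee_fin powR_ge0.
have L0 : (0 <= limn_esup u)%E.
  apply: le_ereal_inf_tmp => _ [V [N _ NV] <-].
  by apply: le_trans (u0 N) _; apply: ereal_sup_ubound; exists N => //; apply: NV => /=.
rewrite /conv_radius -/u; split.
  case: (eqVneq (limn_esup u) +oo%E) => [_|Ly _]; first by rewrite ltxx.
  have : (limn_esup u < +oo)%E by rewrite lt_neqAle Ly leey.
  case/ereal_inf_lt => _ [V [N _ NV] <-] sup_lt.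
  have uV n : (N <= n)%N -> (u n <= ereal_sup [set u x | x in V])%E.
    by move=> Nn; apply: ereal_sup_ubound; exists n => //; apply: NV => /=.
  have [M M0 uM] : exists2 M : R, 0 <= M & forall n, (N <= n)%N -> (u n <= M%:E)%E.
    move: (ereal_sup _) sup_lt uV => [M _ uM|//|_ /(_ N (leqnn _))]; last first.
      by rewrite leNgt (lt_le_trans (ltNyr _) (u0 N)).
    by exists M => //; rewrite -lee_fin (le_trans (u0 N)) ?uM.
  have S0 : 0 <= \sum_(i < N) v (a i) by apply: sumr_ge0 => i _; apply: place_ge0.
  (* [M] bounds the roots from [N] on, the sum covers the first [N] coefficients, and the summand 1
     makes the base at most any of its positive powers. *)
  exists (1 + M + \sum_(i < N) v (a i)) => [|n n0]; first by lra.
  have [Nn|nN] := leqP N n.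
    have := uM n Nn; rewrite lee_fin root_geometric ?place_ge0 // => /le_trans; apply.
    by rewrite lerXn2r ?nnegrE //; lra.
  apply: (@le_trans _ _ (1 + M + \sum_(i < N) v (a i))); last first.
    by apply: ler_eXnr => //; lra.
  rewrite (bigD1 (Ordinal nN)) //=.
  have : 0 <= \sum_(i < N | i != Ordinal nN) v (a i).
    by apply: sumr_ge0 => i _; apply: place_ge0.
  lra.
move=> [C C0 aC].
have LC : (limn_esup u <= C%:E)%E.
  apply: (@le_trans _ _ (ereal_sup [set u n | n in [set n | (0 < n)%N]])).
    by apply: ereal_inf_lbound; exists [set n | (0 < n)%N] => //; exists 1%N.
  apply: ge_ereal_sup => _ [n n0 <-].
  by rewrite lee_fin root_geometric ?(place_ge0 pv) ?(ltW C0) //; exact: aC.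
case: (limn_esup u) L0 LC => // l; rewrite !lee_fin => l0 _ /=.
(* A zero limsup gives infinite radius. *)
case: ifP => [|/negbT l1]; first by rewrite ltry.
by rewrite lte_fin invr_gt0 lt_def l0 andbT; move: l1; rewrite eqe.
Qed.

(** * Majorant series with nonnegative coefficients *)

Lemma fps_pow_ge0 (c : nat -> R) k n : (forall i, 0 <= c i) -> 0 <= fps_pow c k n.
Proof.
move=> c0; elim: k n => [|k IH] n /=; first by rewrite ler0n.
by apply: sumr_ge0 => i _; rewrite mulr_ge0.
Qed.

Lemma place_fps_pow b k n : v (fps_pow b k n) <= fps_pow (v \o b) k n.
Proof.
elim: k n => [|k IH] n /=.
  by case: (n == 0%N); rewrite ?(place0 pv) ?(place1 pv).
apply: le_trans (place_sum pv _ _ _) _; apply: ler_sum => i _.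
by rewrite (placeM pv) ler_wpM2l ?(place_ge0 pv).
Qed.

(** This is the substitution of [r t] for [t], which commutes with powers. *)
Lemma fps_pow_dilate (c : nat -> R) (r : R) k n :
  fps_pow (fun i => c i * r ^+ i) k n = fps_pow c k n * r ^+ n.
Proof.
elim: k n => [|k IH] n /=.
  by case: n => [|n] /=; rewrite ?mulr1 // mul0r.
rewrite mulr_suml; apply: eq_bigr => i _; rewrite IH.
have -> : r ^+ n = r ^+ i * r ^+ (n - i) by rewrite -exprD subnKC // -ltnS.
by ring.
Qed.

Lemma sum_triangle (F : nat -> nat -> R) N :
  \sum_(n < N) \sum_(i < n.+1) F i (n - i)%N = \sum_(i < N) \sum_(j < N - i) F i j.
Proof.
elim: N => [|N IH]; first by rewrite !big_ord0.
rewrite big_ord_recr /= IH [RHS]big_ord_recr /= subSnn big_ord1.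
rewrite [X in _ + X]big_ord_recr /= subnn addrA -big_split /=; congr (_ + _).
by apply: eq_bigr => i _; rewrite subSn 1?ltnW // big_ord_recr.
Qed.

Section Majorant.
Variable c : nat -> R.
Hypotheses (c_ge0 : forall i, 0 <= c i) (c0 : c 0%N = 0).

Let T N := \sum_(i < N) c i.

(** Neither [c] nor its [k]-th power has a constant term, so in total degree at most [N] each factor
    contributes only indices below [N]. This gain of one index lets [T N] control the partial sums
    of length [N.+1]. *)
Lemma sum_fps_powS_le k N : (0 < k)%N ->
  \sum_(n < N.+1) fps_pow c k.+1 n <= T N * \sum_(n < N) fps_pow c k n.
Proof.
move=> k0 /=; rewrite (sum_triangle (fun i j => c i * fps_pow c k j)).
rewrite big_ord_recr /= subSnn big_ord1 (@fps_pow_lt _ _ k) // mulr0 addr0.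
rewrite mulr_suml; apply: ler_sum => -[[|i] /= iN] _.
  by rewrite c0 mul0r big1 // => j _; rewrite mul0r.
rewrite -mulr_sumr ler_wpM2l // subSS.
rewrite (big_ord_widen N (fun j => fps_pow c k j)) ?leq_subr //.
rewrite big_mkcond; apply: ler_sum => j _; case: ifP => // _; exact: fps_pow_ge0.
Qed.

Lemma sum_fps_pow_le k N : \sum_(n < N) fps_pow c k n <= T N ^+ k.
Proof.
have T0 M : 0 <= T M by apply: sumr_ge0.
elim: k => [|k IH].
  case: N => [|N]; first by rewrite big_ord0.
  by rewrite big_ord_recl /= big1 ?addr0.
case: k IH => [|k] IH.
  by rewrite expr1; apply: ler_sum => i _; rewrite fps_pow1.
case: N IH => [|N] IH; first by rewrite big_ord0 exprn_ge0.
apply: le_trans (sum_fps_powS_le _ _) _ => //; rewrite exprS.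
have le_T : T N <= T N.+1 by rewrite /T big_ord_recr /= lerDl.
apply: ler_pM => //; first by apply: sumr_ge0 => i _; exact: fps_pow_ge0.
apply: le_trans IH; rewrite [leRHS]big_ord_recr /= lerDl; exact: (@fps_pow_ge0 _ k.+1).
Qed.

Lemma sum_fps_powS2_le k N : \sum_(n < N.+1) fps_pow c k.+2 n <= T N ^+ k.+2.
Proof.
apply: le_trans (sum_fps_powS_le _ _) _ => //; rewrite exprS.
by apply: ler_wpM2l (sum_fps_pow_le _ _); apply: sumr_ge0.
Qed.

End Majorant.

Lemma sum_geometric_le (x : R) N : 0 <= x -> x <= 2^-1 ->
  \sum_(k < N) x ^+ k.+2 <= 2 * x ^+ 2.
Proof.
move=> x0 x1; suff : (1 - x) * \sum_(k < N) x ^+ k.+2 <= x ^+ 2.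
  have : 0 <= \sum_(k < N) x ^+ k.+2 by apply: sumr_ge0 => i _; rewrite exprn_ge0.
  by move: (\sum_(k < N) _) (x ^+ 2) => S y S0; nra.
suff -> : (1 - x) * \sum_(k < N) x ^+ k.+2 = x ^+ 2 - x ^+ N.+2.
  by rewrite gerBl exprn_ge0.
elim: N => [|N IH]; first by rewrite big_ord0 mulr0 subrr.
by rewrite big_ord_recr /= mulrDr IH !exprS; ring.
Qed.

(* Majorant method: with [T N] the partial sums of [v (b n) * r ^ n], the
   coefficients of [a o b = X] give
   [v (a 1) * T (N + 1) <= r + \sum_(k >= 2) (C * T N) ^ k], and [rho], [r] are
   chosen so that this keeps [T N <= rho] for all [N]. *)
Lemma conv_radius_rinv a b : a 0%N = 0 -> a 1%N != 0 -> b 0%N = 0 ->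
  fps_comp a b = fps_X K -> (0 < conv_radius v a)%E -> (0 < conv_radius v b)%E.
Proof.
move=> a0 a1 b0 ab /conv_radius_gt0P[C C0 aC]; apply/conv_radius_gt0P.
set A := v (a 1%N); have A0 : 0 < A by rewrite /A place_gt0.
(* The two summands of [D] give the two bounds required of [rho = D^-1]: [C * rho <= 1/2], for the
   geometric sum, and [2 * (C * rho)^2 <= A * rho / 2], for the terms of order at least 2. *)
pose D := 2 * C + 4 * C ^+ 2 / A.
have C2 : 0 < C ^+ 2 / A by rewrite divr_gt0 // exprn_gt0.
have D0 : 0 < D by rewrite /D -mulrA; lra.
pose rho := D^-1; have rho0 : 0 < rho by rewrite invr_gt0.
have rhoD : rho * D = 1 by rewrite mulVf // gt_eqF.
have Crho : C * rho <= 2^-1.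
  have : 0 <= rho * (C ^+ 2 / A) by rewrite mulr_ge0 // ltW.
  by move: rhoD; rewrite /D -mulrA; lra.
have Crho2 : 2 * (C * rho) ^+ 2 <= A * rho / 2.
  have : 4 * (C ^+ 2 / A) * rho <= 1.
    have : 0 <= rho * C by rewrite mulr_ge0 // ltW.
    by move: rhoD; rewrite /D -mulrA; lra.
  have -> : (C * rho) ^+ 2 = (A * rho) * ((C ^+ 2 / A) * rho).
    by field; rewrite gt_eqF.
  have : 0 <= A * rho by rewrite mulr_ge0 // ltW.
  by move: (A * rho) (C ^+ 2 / A) => s t; nra.
(* Half of [A * rho] is spent on the linear term, the other half on the higher powers. *)
pose r := A * rho / 2; have r0 : 0 < r by rewrite divr_gt0 // mulr_gt0.
pose c n := v (b n) * r ^+ n.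
have c_ge0 n : 0 <= c n by rewrite mulr_ge0 ?(place_ge0 pv) // exprn_ge0 // ltW.
have c0 : c 0%N = 0 by rewrite /c b0 (place0 pv) mul0r.
have coefb N n : (n < N.+1)%N ->
    A * c n <= (n == 1%N)%:R * r + \sum_(k < N) C ^+ k.+2 * fps_pow c k.+2 n.
  move=> nN.
  (* The coefficient of degree [n] in [a o b = X] is solved for its linear term; powers up to [N.+1]
     suffice because [n <= N]. *)
  have e : a 1%N * b n = (n == 1%N)%:R - \sum_(k < N) a k.+2 * fps_pow b k.+2 n.
    have : fps_comp a b n = (n == 1%N)%:R by rewrite ab.
    rewrite (@fps_comp_widen _ _ _ N.+2) // 1?ltnW // 2!big_ord_recl a0 mul0r add0r.
    by rewrite fps_pow1 => <-; rewrite addrK.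
  have -> : A * c n = v (a 1%N * b n) * r ^+ n by rewrite (placeM pv) /c mulrA.
  rewrite e.
  apply: (@le_trans _ _ (((n == 1%N)%:R + \sum_(k < N) C ^+ k.+2 * fps_pow (v \o b) k.+2 n) * r ^+ n)).
    rewrite ler_pM2r ?exprn_gt0 //; apply: le_trans (placeD pv _ _) _; apply: lerD.
      by case: (n == 1%N); rewrite ?(place0 pv) ?(place1 pv).
    rewrite (placeN pv); apply: le_trans (place_sum pv _ _ _) _; apply: ler_sum => k _.
    rewrite (placeM pv); apply: ler_pM; rewrite ?(place_ge0 pv) ?aC //.
    exact: (place_fps_pow b k.+2 n).
  rewrite mulrDl; apply: lerD; first by case: n {nN e} => [|[|n]] //=; rewrite !mul0r.
  rewrite mulr_suml; apply: ler_sum => k _.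
  by rewrite -mulrA -(@fps_pow_dilate (v \o b)).
have T_le N : \sum_(n < N) c n <= rho.
  elim: N => [|N IH]; first by rewrite big_ord0 ltW.
  have T0 : 0 <= \sum_(n < N) c n by apply: sumr_ge0.
  rewrite -(ler_pM2l A0) mulr_sumr.
  apply: (@le_trans _ _ (\sum_(n < N.+1) ((n == 1%N :> nat)%:R * r +
            \sum_(k < N) C ^+ k.+2 * fps_pow c k.+2 n))).
    by apply: ler_sum => n _; apply: coefb.
  rewrite big_split /= exchange_big /=.
  have -> : A * rho = r + A * rho / 2 by rewrite /r; field.
  apply: lerD.
    rewrite -mulr_suml ler_piMl ?(ltW r0) //; case: N {IH T0} => [|N].
      by rewrite big_ord1 lern1.
    by rewrite 2!big_ord_recl /= big1 // addr0 add0r.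
  apply: le_trans Crho2; apply: le_trans (sum_geometric_le N _ Crho); last first.
    by rewrite mulr_ge0 // ltW.
  apply: ler_sum => k _; rewrite -mulr_sumr exprMn ler_wpM2l ?exprn_ge0 ?(ltW C0) //.
  apply: le_trans (sum_fps_powS2_le c_ge0 c0 k N) _.
  by rewrite lerXn2r // nnegrE // ltW.
have r1 : 0 < (1 + rho) / r by rewrite divr_gt0 // addr_gt0.
(* A single term is at most [rho], hence at most [1 + rho], whose powers dominate it since it is at
   least 1. *)
exists ((1 + rho) / r) => // n n0.
rewrite expr_div_n ler_pdivlMr ?exprn_gt0 //.
apply: (@le_trans _ _ (1 + rho)); last by apply: ler_eXnr => //; lra.
have := T_le n.+1; rewrite big_ord_recr /= -/(c n).
have : 0 <= \sum_(i < n) c i by apply: sumr_ge0.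
by lra.
Qed.

End ConvRadius.

(** * Integrality of the inverse *)

Section Integrality.
Variables (R : realType) (K : fieldType) (v : K -> R).
Hypotheses (pv : place v) (nav : ~ archimedean v).

Lemma fps_pow_le1 (a : nat -> K) k n :
  (forall i, v (a i) <= 1) -> v (fps_pow a k n) <= 1.
Proof.
move=> a1; elim: k n => [|k IH] n /=; first exact: place_nat.
apply: (place_ultra_sum pv nav) => // i _.
by rewrite (placeM pv) mulr_ile1 ?(place_ge0 pv).
Qed.

(** The recursion divides only by powers of [a 1], which have norm 1. *)
Lemma fps_linv_le1 (a : nat -> K) n : (forall i, v (a i) <= 1) ->
  v (a 1%N) = 1 -> v (fps_linv a n) <= 1.
Proof.
move=> a_le1 va1; elim/ltn_ind: n => n IH.
rewrite fps_linvE (placeM pv) (placeV pv) (placeX pv) va1 expr1n invr1 mulr1.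
apply: le_trans (place_ultra nav _ _) _; rewrite ge_max (place_nat pv nav) (placeN pv).
apply: (place_ultra_sum pv nav) => // k _.
by rewrite (placeM pv) mulr_ile1 ?(place_ge0 pv) ?IH ?fps_pow_le1.
Qed.

End Integrality.

(** * The left inverse is adelic *)

Theorem lemma3p1 (R : realType) (K : fieldExtType rat) (a : nat -> K) :
  adelic R a -> a 0%N = 0 -> a 1%N != 0 ->
  exists b : nat -> K, adelic R b /\ fps_comp b a = fps_X K.
Proof.
move=> [[m [S [pS archS intS]]] rad_a] a0 a1.
exists (fps_linv a); split; last exact: fps_linvK.
split=> [|v pv]; last first.
  apply: (conv_radius_rinv pv a0 a1) (rad_a v pv); first exact: fps_linv0.
  exact: fps_linvKr.
have [n [f [pf Hf]]] := place_lt1_finite R a1.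
(* The new finite set is [S] together with representatives of the places where [a 1] has norm below
   1. *)
have [h [hP hS hf]] := family_cat S f; exists (m + n)%N, h; split.
- exact: hP.
- move=> v pv /(archS v pv)[i vi].
  by have [j hj] := hS i; exists j; rewrite hj.
move=> v pv vh k.
have vS i : ~ equiv_place v (S i) by have [j <-] := hS i.
have nav : ~ archimedean v by move=> /(archS v pv)[i /vS].
have a_le1 := intS v pv vS.
(* Outside the enlarged set [a 1] is a unit: its norm is at most 1 by integrality outside [S], and
   norm below 1 would make [v] equivalent to some [f i]. *)
apply: (fps_linv_le1 pv nav) => //; apply/eqP; rewrite eq_le a_le1 leNgt.
apply/negP => /(Hf v pv nav)[i]; have [j <-] := hf i; exact: vh.
Qed.
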